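(* Let $0\leq\alpha_R,\alpha_F<1$, let $R=\begin{bmatrix}1&-\alpha_R\\-\alpha_F&1\end{bmatrix}$, let $A_{\mathrm{D}}:\mathbb{R}\rightrightarrows\mathbb{R}$ satisfy $(A_{\mathrm{D}},\mathrm{id})\in\mathcal{M}_0$, and define the operator $A_{\mathrm{NPN}}:\mathbb{R}^2\rightrightarrows\mathbb{R}^2$ by $$A_{\mathrm{NPN}}\begin{bmatrix} v_1 \\ v_2 \end{bmatrix}=\left\{R\begin{bmatrix} u_1 \\ u_2 \end{bmatrix}:u_1\in A_{\mathrm{D}}(v_1),\ u_2\in A_{\mathrm{D}}(v_2)\right\}.$$ Then $(A_{\mathrm{NPN}},B)\in\mathcal{M}_0$, where $B=(\det R)R^{-\top}=\begin{bmatrix}1&\alpha_F\\ \alpha_R&1\end{bmatrix}$.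
   Context: For a set-valued operator $A:\mathcal{H}\rightrightarrows\mathcal{H}$ on a real Hilbert space $\mathcal{H}$, $\operatorname{gph}A=\{(x,u):u\in A(x)\}$; matrices are identified with the linear maps they define, and $\mathrm{id}$ is the identity operator. $\mathcal{M}_0$ is the class of monotone operator pairs: $(A,B)\in\mathcal{M}_0$ iff $\langle u_A-\bar u_A,u_B-\bar u_B\rangle\geq0$ for all $(x,u_A),(\bar x,\bar u_A)\in\operatorname{gph}A$ and $(x,u_B),(\bar x,\bar u_B)\in\operatorname{gph}B$. In particular $(A_{\mathrm{D}},\mathrm{id})\in\mathcal{M}_0$ means that $A_{\mathrm{D}}$ is monotone in the classical sense. *)

(* Defs.v *)
From HB Require Import structures.
From mathcomp Require Import all_boot all_order all_algebra.
From mathcomp Require Import sesquilinear.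
From mathcomp Require Import boolp classical_sets reals.
Set Implicit Arguments.
Unset Strict Implicit.
Unset Printing Implicit Defensive.
Import Order.TTheory GRing.Theory Num.Theory.
Local Open Scope classical_set_scope.
Local Open Scope ring_scope.

(* A set-valued operator on U is a function [U -> set U]. *)
Definition gph (U : Type) (A : U -> set U) : set (U * U) :=
  [set p | A p.1 p.2].

(* A map seen as the set-valued operator x |-> {f x}. *)
Definition single_valued (U : Type) (f : U -> U) : U -> set U :=
  fun x => [set f x].

(* The class M_0 on a real inner product space (U, ip). A real Hilbert space is
   such a space that is moreover complete; the definition does not involve
   completeness, and it is used below only in finite dimension. *)
Definition monotone_pair (R : realType) (U : lmodType R)
    (ip : {dot U for idfun}) (A B : U -> set U) : Prop :=
  forall x x' uA uA' uB uB' : U,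
    gph A (x, uA) -> gph A (x', uA') ->
    gph B (x, uB) -> gph B (x', uB') ->
    0 <= ip (uA - uA') (uB - uB').

(* The standard inner product on R, regarded as a vector space over itself. *)
Definition rdot (R : realType) (x y : R^o) : R := (x : R) * (y : R).

(* The standard inner product on R^n. *)
Definition cdot (R : realType) (n : nat) (u v : 'cV[R]_n) : R :=
  \sum_(i < n) u i 0 * v i 0.

Section InnerProducts.
Variable R : realType.

Let rdotl (y : R^o) : linear_for *%R ((@rdot R)^~ y).
Proof. by move=> a u v; rewrite /rdot mulrDl mulrA. Qed.

Let rdotr (x : R^o) : linear_for *%R (@rdot R x).
Proof. by move=> a u v; rewrite /rdot mulrDr mulrCA. Qed.

HB.instance Definition _ :=
  @bilinear_isBilinear.Build R R^o R^o R *%R *%R (@rdot R) (rdotl, rdotr).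

Let rdot_sym (x y : R^o) : rdot x y = (-1) ^+ false * idfun (rdot y x).
Proof. by rewrite expr0 mul1r /rdot mulrC. Qed.

HB.instance Definition _ :=
  @isHermitianSesquilinear.Build R R^o false idfun (@rdot R) rdot_sym.

Let rdot_gt0 (x : R^o) : x != 0 -> 0 < rdot x x.
Proof. by move=> x0; rewrite /rdot -expr2 exprn_even_gt0. Qed.

HB.instance Definition _ := isDotProduct.Build R R^o (@rdot R) rdot_gt0.

Variable n : nat.

Let cdotl (v : 'cV[R]_n) : linear_for *%R ((@cdot R n)^~ v).
Proof.
move=> a u w; rewrite /cdot mulr_sumr -big_split; apply: eq_bigr => i _ /=.
by rewrite !mxE mulrDl mulrA.
Qed.

Let cdotr (u : 'cV[R]_n) : linear_for *%R (@cdot R n u).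
Proof.
move=> a v w; rewrite /cdot mulr_sumr -big_split; apply: eq_bigr => i _ /=.
by rewrite !mxE mulrDr mulrCA.
Qed.

HB.instance Definition _ :=
  @bilinear_isBilinear.Build R 'cV[R]_n 'cV[R]_n R *%R *%R
    (@cdot R n) (cdotl, cdotr).

Let cdot_sym (u v : 'cV[R]_n) : cdot u v = (-1) ^+ false * idfun (cdot v u).
Proof.
by rewrite expr0 mul1r; apply: eq_bigr => i _; rewrite mulrC.
Qed.

HB.instance Definition _ :=
  @isHermitianSesquilinear.Build R 'cV[R]_n false idfun (@cdot R n) cdot_sym.

Let cdot_gt0 (u : 'cV[R]_n) : u != 0 -> 0 < cdot u u.
Proof.
move=> u0; have ge0 i : 0 <= u i 0 * u i 0 by rewrite -expr2 sqr_ge0.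
rewrite lt_def sumr_ge0 // andbT; apply: contra u0 => /eqP/psumr_eq0P => h.
apply/eqP/colP => i; rewrite mxE; apply/eqP.
by rewrite -[_ == _]orbb -mulf_eq0 h.
Qed.

HB.instance Definition _ := isDotProduct.Build R 'cV[R]_n (@cdot R n) cdot_gt0.

End InnerProducts.

Definition col2 (R : realType) (a b : R) : 'cV[R]_2 :=
  \col_i (if i == 0 then a else b).

(* The matrix with rows (a, b) and (c, d). *)
Definition mx2 (R : realType) (a b c d : R) : 'M[R]_2 :=
  \matrix_(i, j) (if i == 0 then if j == 0 then a else b
                  else if j == 0 then c else d).

Definition NPN_mx (R : realType) (alphaR alphaF : R) : 'M[R]_2 :=
  mx2 1 (- alphaR) (- alphaF) 1.

(* The row indices 0 and 1 stand for the coordinates 1 and 2. *)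
Definition NPN (R : realType) (alphaR alphaF : R) (AD : R -> set R) :
    'cV[R]_2 -> set 'cV[R]_2 :=
  fun v => [set NPN_mx alphaR alphaF *m col2 u1 u2
           | u1 in AD (v 0 0) & u2 in AD (v 1 0)].

(* Main.v *)
Require Import Defs.
From mathcomp Require Import all_boot all_order all_algebra.
From mathcomp Require Import sesquilinear.
From mathcomp Require Import boolp classical_sets reals.
From mathcomp Require Import ring lra.
Import Order.TTheory GRing.Theory Num.Theory.
Local Open Scope classical_set_scope.
Local Open Scope ring_scope.

(** Since [B = det M *: M^-T], pairing [M u] with [B v] gives [det M] times the
    pairing of [u] with [v]; here [det M = 1 - alphaR * alphaF > 0], and the
    pairing of [u] with [v] is nonnegative coordinatewise because [AD] is
    monotone. *)

Lemma cdot_mulmxl (R : realType) (m n : nat) (A : 'M[R]_(m, n))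
    (u : 'cV[R]_n) (v : 'cV[R]_m) :
  cdot (A *m u) v = cdot u (A^T *m v).
Proof.
(* Read as the entry of a 1 by 1 matrix product, the pairing reduces adjointness to
   associativity. *)
have cdotE k (a b : 'cV[R]_k) : cdot a b = (a^T *m b) 0 0.
  by rewrite mxE; apply: eq_bigr => i _; rewrite mxE.
by rewrite !cdotE trmx_mul mulmxA.
Qed.

(** [M] crosses the pairing as [M^T], which cancels the transposed inverse; only the scalar [\det M]
    survives. *)
Lemma cdot_mulmx_cofactor (R : realType) (n : nat) (M : 'M[R]_n)
    (u v : 'cV[R]_n) : M \in unitmx ->
  cdot (M *m u) ((\det M *: (invmx M)^T) *m v) = \det M * cdot u v.
Proof.
move=> Mu; rewrite cdot_mulmxl mulmxA -scalemxAr trmx_inv mulmxV ?unitmx_tr//.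
by rewrite -scalemxAl mul1mx linearZr_LR.
Qed.

Lemma det_mx2 (R : realType) (a b c d : R) :
  \det (mx2 a b c d) = a * d - b * c.
Proof.
rewrite (expand_det_row _ 0) !big_ord_recl big_ord0 /cofactor !det_mx11 !mxE /=.
by rewrite expr0 expr1; ring.
Qed.

(** The second factor is the adjugate, in closed form for size 2. *)
Lemma mulmx_adj_mx2 (R : realType) (a b c d : R) :
  mx2 a b c d *m mx2 d (- b) (- c) a = (\det (mx2 a b c d))%:M.
Proof.
rewrite det_mx2; apply/matrixP => i j; rewrite !mxE !big_ord_recl big_ord0 !mxE.
case: i => [[|[|//]] i2]; case: j => [[|[|//]] j2]; rewrite /= ?mulr1n ?mulr0n; ring.
Qed.

Lemma tr_mx2 (R : realType) (a b c d : R) : (mx2 a b c d)^T = mx2 a c b d.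
Proof.
by apply/matrixP => i j; rewrite !mxE; case: ifP; case: ifP.
Qed.

Lemma cofactor_mx2 (R : realType) (a b c d : R) : mx2 a b c d \in unitmx ->
  \det (mx2 a b c d) *: (invmx (mx2 a b c d))^T = mx2 d (- c) (- b) a.
Proof.
(* The scalar goes inside the transpose and becomes a right factor [(\det M)%:M], that is, [M] times
   its adjugate; [invmx M] then cancels [M]. *)
move=> Mu; rewrite -linearZ/= -mul_mx_scalar -mulmx_adj_mx2.
by rewrite mulKmx// tr_mx2.
Qed.

Lemma det_NPN_mx_gt0 (R : realType) (alphaR alphaF : R) :
  0 <= alphaR < 1 -> 0 <= alphaF < 1 -> 0 < \det (NPN_mx alphaR alphaF).
Proof. by move=> /andP[r0 r1] /andP[f0 f1]; rewrite det_mx2; nra. Qed.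

Theorem mainTheorem9 (R : realType) (alphaR alphaF : R)
    (halphaR : 0 <= alphaR < 1) (halphaF : 0 <= alphaF < 1)
    (AD : R -> set R)
    (hAD : monotone_pair (@rdot R) AD (single_valued id)) :
  let M := NPN_mx alphaR alphaF in
  let B := \det M *: (invmx M)^T in
  B = mx2 1 alphaF alphaR 1 /\
  monotone_pair (@cdot R 2) (NPN alphaR alphaF AD) (single_valued (mulmx B)).
Proof.
move=> M B; have detM : 0 < \det M by exact: det_NPN_mx_gt0.
have Mu : M \in unitmx by rewrite unitmxE unitfE gt_eqF.
split; first by rewrite /B cofactor_mx2// !opprK.
move=> x x' uA uA' uB uB' [u1 Au1 [u2 Au2 /= <-]] [w1 Aw1 [w2 Aw2 /= <-]].
(* Membership in the graph of [B] forces [uB = B x] and [uB' = B x'], so by linearity both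
   differences are images of differences. *)
rewrite /gph /single_valued /= => -> ->; rewrite -!mulmxBr cdot_mulmx_cofactor//.
apply: mulr_ge0; first exact: ltW.
have AD_mono s t p q : AD s p -> AD t q -> 0 <= (p - q) * (s - t).
  (* The graph of the identity pairs each point with itself, so [s] and [t] serve both as points and
     as their images. *)
  by move=> sp tq; exact: (hAD s t p q s t).
rewrite /cdot !big_ord_recl big_ord0 addr0 !mxE/=.
apply: addr_ge0; first exact: AD_mono.
(* The second index of the unfolded sum is a [lift], equal to 1 by its value. *)
by rewrite (_ : lift _ _ = 1); [exact: AD_mono|exact/val_inj].
Qed.
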